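(* Let $\mathsf{CS}$ be a constant specification for $\mathsf{FOLP}$ and let $A$ be a sentence of $\mathsf{FOLP}$. If $A$ is $\mathsf{FOLP}_{\mathsf{CS}}$-valid, i.e. true in every (Mkrtychev) $\mathsf{FOLP}_{\mathsf{CS}}$-model, then $A$ has an $\mathsf{FOLP}_{\mathsf{CS}}$-tableau proof.
   Context: **Language.** $Var$ is a countable set of individual variables $x,y,\dots$; there are no constant symbols, function symbols or identity. Justification terms: $t::=p\mid c\mid t+t\mid t\cdot t\mid {!t}\mid gen_x(t)$, with $p$ in a countable set $JVar$ of justification variables, $c$ in a countable set $JCons$ of justification constants, $x\in Var$. $\mathsf{FOLP}$ formulas: $A::=Q(x_1,\dots,x_n)\mid\neg A\mid A\to A\mid\forall xA\mid\exists xA\mid t:_XA$, where $Q$ is an $n$-place predicate symbol (countably many, of any arity), $t$ is a term, $X\subseteq Var$ is a finite set. Free occurrences are as in first order logic, and additionally the free occurrences in $t:_XA$ are the free occurrences in $A$ of variables belonging to $X$, together with all occurrences in $X$ itself; so $FVar(t:_XA)=X$. Accordingly, substituting for $x$ in $t:_XA$ replaces $x$ in $X$ and at its free occurrences in $A$ if $x\in X$, and changes nothing if $x\notin X$. A sentence is a formula with no free individual variables. $t:A$ means $t:_\emptyset A$. $Xy$ means $X\cup\{y\}$ and implies $y\notin X$. $\forall A$ is the universal closure of $A$ (over its free individual variables). **$K$-formulas.** For a nonempty set $K$, a $K$-formula is the result of substituting members of $K$ for some free individual variables of an $\mathsf{FOLP}$ formula; it is closed if it has no free occurrences of individual variables;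 $K(A)$ is the set of members of $K$ occurring in $A$. $A(a)$ denotes the result of replacing all free occurrences of $x$ in $A(x)$ by $a$. **Axioms and constant specifications.** The axioms of $\mathsf{FOLP}$ are all instances of: axiom schemes of (a standard axiomatization of) first order logic; $t:_{Xy}A\to t:_XA$ with $y\notin FVar(A)$; $t:_XA\to t:_{Xy}A$; $s:_XA\to(s+t):_XA$ and $s:_XA\to(t+s):_XA$; $s:_X(A\to B)\to(t:_XA\to(s\cdot t):_XB)$; $t:_XA\to A$; $t:_XA\to{!t}:_Xt:_XA$; $t:_XA\to gen_x(t):_X\forall xA$ with $x\notin X$. A constant specification $\mathsf{CS}$ is a set of formulas $c:A$ with $c$ a justification constant and $A$ an axiom instance. **Models.** An $\mathsf{FOLP}_{\mathsf{CS}}$-model is $\mathcal M=(\mathcal D,\mathcal I,\mathcal E)$ with $\mathcal D$ a nonempty set, $\mathcal I$ assigning to each $n$-place predicate symbol an $n$-ary relation on $\mathcal D$, and $\mathcal E$ assigning to each justification term a set of $\mathcal D$-formulas such that: ($\mathcal E1$) $c:A\in\mathsf{CS}$ implies $A\in\mathcal E(c)$; ($\mathcal E2$) $A\to B\in\mathcal E(s)$ and $A\in\mathcal E(t)$ imply $B\in\mathcal E(s\cdot t)$; ($\mathcal E3$) $\mathcal E(s)\cup\mathcal E(t)\subseteq\mathcal E(s+t)$; ($\mathcal E4$) $A\in\mathcal E(t)$ implies $t:_XA\in\mathcal E(!t)$ whenever $\mathcal D(A)\subseteq X\subseteq\mathcal D$; ($\mathcal E5$) $A\in\mathcal E(t)$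 implies $\forall xA\in\mathcal E(gen_x(t))$; ($\mathcal E6$) $a\in\mathcal D$ and $A(x)\in\mathcal E(t)$ imply $A(a)\in\mathcal E(t)$. (As everywhere, $X$ in $t:_XA$ is finite.) Truth of closed $\mathcal D$-formulas: $\mathcal M\Vdash Q(\vec a)$ iff $\vec a\in\mathcal I(Q)$; $\neg,\to$ classically; $\mathcal M\Vdash\forall xA(x)$ (resp. $\exists xA(x)$) iff $\mathcal M\Vdash A(a)$ for every (resp. some) $a\in\mathcal D$; $\mathcal M\Vdash t:_XA$ iff $A\in\mathcal E(t)$ and $\mathcal M\Vdash\forall A$. **Tableaux.** $Par$ is a denumerable set of new individual variables (parameters $\mathsf u,\mathsf v,\dots$), disjoint from $Var$ and never quantified; a $Par$-formula is the result of substituting parameters for some free individual variables of an $\mathsf{FOLP}$ formula, it is closed if it has no free occurrences of individual variables from $Var$ (it may contain parameters), and $Par(A)$ is the set of parameters occurring in $A$. An $\mathsf{FOLP}_{\mathsf{CS}}$-tableau for a finite set $S$ of closed $Par$-formulas is a binary tree labeled by closed $Par$-formulas, starting with a single branch consisting of the formulas of $S$, and obtained by finitely many applications of the following rules to formulas occurring on a branch (the conclusions extend the branch; ''$|$'' splits it). In the rules for justification formulas $X\subseteq Par$. - $(F\neg)$: $\neg\neg A$ / $A$. - $(T\to)$: $A\to B$ / $\neg A\mid B$. $(F\to)$: $\neg(A\to B)$ / $A,\neg B$. - $(T\forall)$: $\forall xA(x)$ / $A(\mathsf u)$, any parameter $\mathsf u$. $(F\exists)$: $\neg\exists xA(x)$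 / $\neg A(\mathsf u)$, any parameter $\mathsf u$. - $(T\exists)$: $\exists xA(x)$ / $A(\mathsf u)$, $\mathsf u$ new to the branch. $(F\forall)$: $\neg\forall xA(x)$ / $\neg A(\mathsf u)$, $\mathsf u$ new to the branch. - $(T:)$: $t:_XA$ / $\forall A$. - $(F+)$: $\neg\,t+s:_XA$ / $\neg t:_XA,\ \neg s:_XA$. - $(F\cdot)$: $\neg\,s\cdot t:_XB$ / $\neg s:_X(A\to B)\mid\neg t:_XA$, for any $Par$-formula $A$ with $Par(A)\subseteq X$. - $(F!)$: $\neg\,{!t}:_Xt:_XA$ / $\neg t:_XA$. - $(Ctr)$: $\neg t:_XA$ / $\neg t:_{X\mathsf u}A$. - $(Exp)$: $\neg t:_{X\mathsf u}A$ / $\neg t:_XA$, provided $\mathsf u\notin Par(A)$. - $(Ins)$: $\neg t:_XA(\mathsf u)$ / $\neg t:_XA(x)$, where $A(\mathsf u)$ is $A(x)$ with all free occurrences of $x$ replaced by $\mathsf u$ ($A(x)$ may itself contain $\mathsf u$). - $(gen_x)$: $\neg gen_x(t):_X\forall xA$ / $\neg t:_XA$. A branch closes if it contains both $A$ and $\neg A$ for some closed $Par$-formula $A$, or contains $\neg c:A$ for some $c:A\in\mathsf{CS}$. A tableau closes if all its branches close. An $\mathsf{FOLP}_{\mathsf{CS}}$-tableau proof of a sentence $F$ is a closed tableau for $\{\neg F\}$. *)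

(* Defs.v *)
From Stdlib Require List.
From mathcomp Require Import all_boot finmap.

Set Implicit Arguments.
Unset Strict Implicit.
Unset Printing Implicit Defensive.

Local Open Scope fset_scope.
Local Open Scope nat_scope.

(** * Language *)

Notation Var := nat (only parsing).
Notation JVar := nat (only parsing).
Notation JCons := nat (only parsing).
Notation Par := nat (only parsing).

(* For every n there are denumerably many n-place predicate symbols. *)
Record psym := PSym { arity : nat; pidx : nat }.

Inductive term : Type :=
| JV of JVar
| JC of JCons
| Plus of term & term
| Times of term & term
| Bang of term
| Gen of Var & term.

(* An individual: a variable [inl x] or a member [inr a] of K.  Parameters are
   the case K = Par: they are never quantified, so they are treated exactly
   like elements of a domain. *)
Definition ind (K : choiceType) : choiceType := (Var + K)%type.

(* Expressions over Var + K; [Box t X A] is t:_X A.  The formulas of FOLP are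
   the elements of [fml void].  Not every element of [fml K] is a K-formula:
   see [Kformula]. *)
Inductive fml (K : choiceType) : Type :=
| Atom (Q : psym) of (arity Q).-tuple (ind K)
| Neg of fml K
| Imp of fml K & fml K
| All of Var & fml K
| Ex of Var & fml K
| Box of term & {fset ind K} & fml K.

Definition formula := fml void.

(* t:_X A with X included in K *)
Definition BoxK (K : choiceType) (t : term) (X : {fset K}) (A : fml K) : fml K :=
  Box t [fset (inr a : ind K) | a in X] A.

Definition ivar (K : choiceType) (i : ind K) : option Var :=
  if i is inl x then Some x else None.
Definition icst (K : choiceType) (i : ind K) : option K :=
  if i is inr a then Some a else None.

Fixpoint fvar (K : choiceType) (A : fml K) : {fset Var} :=
  match A with
  | Atom _ args => [fset x in pmap (@ivar K) args]
  | Neg A => fvar A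
  | Imp A B => fvar A `|` fvar B
  | All x A | Ex x A => fvar A `\ x
  | Box _ X _ => [fset x in pmap (@ivar K) X]
  end.

(* K(A), the members of K occurring in A *)
Fixpoint kset (K : choiceType) (A : fml K) : {fset K} :=
  match A with
  | Atom _ args => [fset a in pmap (@icst K) args]
  | Neg A => kset A
  | Imp A B => kset A `|` kset B
  | All _ A | Ex _ A => kset A
  | Box _ X A => [fset a in pmap (@icst K) X] `|` kset A
  end.

Definition closed (K : choiceType) (A : fml K) : Prop := fvar A = fset0.

Definition sentence (A : formula) : Prop := closed A.

Definition isub (K : choiceType) (x : Var) (e i : ind K) : ind K :=
  if i == inl x then e else i.

(* A with e replacing the free occurrences of x; bound variables are not
   renamed. *)
Fixpoint sub (K : choiceType) (x : Var) (e : ind K) (A : fml K) : fml K :=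
  match A with
  | Atom Q args => Atom (map_tuple (isub x e) args)
  | Neg A => Neg (sub x e A)
  | Imp A B => Imp (sub x e A) (sub x e B)
  | All y A => All y (if y == x then A else sub x e A)
  | Ex y A => Ex y (if y == x then A else sub x e A)
  | Box t X A =>
      if inl x \in X then Box t [fset isub x e i | i in X] (sub x e A)
      else Box t X A
  end.

Definition inst (K : choiceType) (x : Var) (a : K) (A : fml K) : fml K :=
  sub x (inr a) A.

(* Universal closure; the order of the quantifiers is an arbitrary fixed one. *)
Definition uclos (K : choiceType) (A : fml K) : fml K :=
  foldr (@All K) A (enum_fset (fvar A)).

Definition iemb (K : choiceType) (i : ind void) : ind K :=
  match i with inl x => inl x | inr v => of_void (ind K) v end.

Fixpoint emb (K : choiceType) (A : formula) : fml K :=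
  match A with
  | Atom Q args => Atom (map_tuple (@iemb K) args)
  | Neg A => Neg (emb K A)
  | Imp A B => Imp (emb K A) (emb K B)
  | All x A => All x (emb K A)
  | Ex x A => Ex x (emb K A)
  | Box t X A => Box t [fset iemb K i | i in X] (emb K A)
  end.

(* In particular, if t:_X A is a K-formula then K(A) is included in X; this
   excludes expressions such as t:_{x} Q(x, a). *)
Inductive Kformula (K : choiceType) : fml K -> Prop :=
| Kformula_emb (A : formula) : Kformula (emb K A)
| Kformula_inst (A : fml K) (x : Var) (a : K) :
    Kformula A -> Kformula (inst x a A).

(** * Axioms and constant specifications *)

(* y is free for x in A.  Replacing x by y in t:_X A with x in X puts y into
   the index set, so it captures the free occurrences of y in A unless y is
   already in X. *)
Fixpoint free_for (K : choiceType) (y x : Var) (A : fml K) : bool :=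
  match A with
  | Atom _ _ => true
  | Neg A => free_for y x A
  | Imp A B => free_for y x A && free_for y x B
  | All z A | Ex z A =>
      (x \notin fvar A `\ z) || (z != y) && free_for y x A
  | Box _ X A =>
      (inl x \notin X) ||
      free_for y x A && ((y \in fvar A) ==> (inl y \in X))
  end.

(* The first order schemes are those of the usual Hilbert system whose rules
   are modus ponens and generalization. *)
Inductive axiom : formula -> Prop :=
| ax_K A B : axiom (Imp A (Imp B A))
| ax_S A B C :
    axiom (Imp (Imp A (Imp B C)) (Imp (Imp A B) (Imp A C)))
| ax_N A B : axiom (Imp (Imp (Neg A) (Neg B)) (Imp B A))
| ax_all_inst x y A :
    free_for y x A -> axiom (Imp (All x A) (sub x (inl y) A))
| ax_ex_inst x y A :
    free_for y x A -> axiom (Imp (sub x (inl y) A) (Ex x A))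
| ax_all_dist x A B :
    x \notin fvar A -> axiom (Imp (All x (Imp A B)) (Imp A (All x B)))
| ax_ex_dist x A B :
    x \notin fvar B -> axiom (Imp (All x (Imp A B)) (Imp (Ex x A) B))
| ax_ctr t X y A :
    inl y \notin X -> y \notin fvar A ->
    axiom (Imp (Box t (inl y |` X) A) (Box t X A))
| ax_exp t X y A :
    inl y \notin X -> axiom (Imp (Box t X A) (Box t (inl y |` X) A))
| ax_plusl s t X A : axiom (Imp (Box s X A) (Box (Plus s t) X A))
| ax_plusr s t X A : axiom (Imp (Box s X A) (Box (Plus t s) X A))
| ax_app s t X A B :
    axiom (Imp (Box s X (Imp A B)) (Imp (Box t X A) (Box (Times s t) X B)))
| ax_refl t X A : axiom (Imp (Box t X A) A)
| ax_bang t X A : axiom (Imp (Box t X A) (Box (Bang t) X (Box t X A)))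
| ax_gen t X x A :
    inl x \notin X -> axiom (Imp (Box t X A) (Box (Gen x t) X (All x A))).

Definition const_spec (CS : formula -> Prop) : Prop :=
  forall F, CS F -> exists c A, F = Box (JC c) fset0 A /\ axiom A.

(** * Models *)

(* Requiring a choiceType rather than a bare type is no restriction: classically
   every type carries such a structure. *)
Record model (CS : formula -> Prop) : Type := Model {
  dom : choiceType;
  dom_nonempty : inhabited dom;
  interp : forall Q : psym, (arity Q).-tuple dom -> Prop;
  evid : term -> fml dom -> Prop;
  evid_Kformula : forall t A, evid t A -> Kformula A;
  evid_cs : forall c A, CS (Box (JC c) fset0 A) -> evid (JC c) (emb dom A);
  evid_app : forall s t A B,
    evid s (Imp A B) -> evid t A -> evid (Times s t) B;
  evid_plus : forall s t A, evid s A \/ evid t A -> evid (Plus s t) A;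
  evid_bang : forall t A (X : {fset dom}),
    evid t A -> kset A `<=` X -> evid (Bang t) (BoxK t X A);
  evid_gen : forall t x A, evid t A -> evid (Gen x t) (All x A);
  evid_inst : forall t x (a : dom) A, evid t A -> evid t (inst x a A)
}.

(* Truth is defined by recursion on this measure, which decreases from t:_X A
   to the universal closure of A; the clauses are the lemmas [forces_*]. *)
Fixpoint msr (K : choiceType) (A : fml K) : nat :=
  match A with
  | Atom _ _ => 1
  | Neg A => (msr A).+1
  | Imp A B => (msr A + msr B).+1
  | All _ A | Ex _ A => (msr A).+1
  | Box _ _ A => (msr A + #|` fvar A|).+1
  end.

Fixpoint forces_rec (CS : formula -> Prop) (M : model CS) (n : nat)
    (A : fml (dom M)) : Prop :=
  if n is n'.+1 then
    match A with
    | Atom Q args =>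
        exists2 a : (arity Q).-tuple (dom M),
          args = map_tuple (@inr Var (dom M)) a & @interp CS M Q a
    | Neg A => ~ forces_rec n' A
    | Imp A B => forces_rec n' A -> forces_rec n' B
    | All x A => forall a : dom M, forces_rec n' (inst x a A)
    | Ex x A => exists a : dom M, forces_rec n' (inst x a A)
    | Box t X A => evid t A /\ forces_rec n' (uclos A)
    end
  else False.

Definition forces (CS : formula -> Prop) (M : model CS) (A : fml (dom M)) :
  Prop := forces_rec (msr A) A.

Arguments forces {CS} M A.

Lemma fvar_inst (K : choiceType) (x : Var) (a : K) (A : fml K) :
  fvar (inst x a A) `<=` fvar A.
Proof.
have ivar_sub i y : ivar (isub x (inr a : ind K) i) = Some y -> i = inl y.
  by rewrite /isub; case: eqP => // _; case: i => //= z [->].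
rewrite /inst; elim: A => [Q args|A IH|A IHA B IHB|y A IH|y A IH|t X A IH] //=.
- apply/fsubsetP => y; rewrite !inE !mem_pmap.
  by move=> /mapP[_ /mapP[i iargs ->]] /esym/ivar_sub iE; apply/mapP;
     exists i => //; rewrite iE.
- exact: fsetUSS.
- by case: eqP => // _; apply: fsetSD.
- by case: eqP => // _; apply: fsetSD.
- case: ifP => //= _; apply/fsubsetP => y; rewrite !inE !mem_pmap.
  move=> /mapP[j /imfsetP[i /= iX ->]] /esym/ivar_sub iE.
  by apply/mapP; exists i => //; rewrite iE.
Qed.

Lemma msr_inst (K : choiceType) (x : Var) (a : K) (A : fml K) :
  msr (inst x a A) <= msr A.
Proof.
have fv B := fsubset_leq_card (fvar_inst x a B).
rewrite /inst in fv *; elim: A => [Q args|A IH|A IHA B IHB|y A IH|y A IH|t X A IH] //=.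
- by rewrite ltnS leq_add.
- by case: eqP.
- by case: eqP.
- by case: ifP => //= _; rewrite ltnS leq_add.
Qed.

Lemma msr_uclos (K : choiceType) (A : fml K) :
  msr (uclos A) = msr A + #|` fvar A|.
Proof.
rewrite /uclos; elim: (enum_fset _) => [|x s IH] /=; first by rewrite addn0.
by rewrite IH addnS.
Qed.

Lemma forces_rec_msr (CS : formula -> Prop) (M : model CS) (n : nat)
    (A : fml (dom M)) :
  msr A <= n -> forces_rec n A <-> forces M A.
Proof.
rewrite /forces; elim/ltn_ind: n A => n IHn A le_n.
have step m (B : fml (dom M)) : msr B <= m -> m < msr A ->
    forces_rec n.-1 B <-> forces_rec m B.
  move=> leBm ltm; have n_gt0 : 0 < n by apply: leq_trans le_n; case: (msr A) ltm.
  have lt1 : n.-1 < n by rewrite prednK.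
  have lemn : m <= n.-1 by rewrite -ltnS prednK // (leq_trans ltm).
  apply: (iff_trans (IHn _ lt1 _ (leq_trans leBm lemn))).
  by apply: iff_sym; apply: IHn => //; apply: leq_ltn_trans lemn _.
case: n le_n IHn step => [|n]; first by case: A.
case: A => [Q args|A|A B|x A|x A|t X A] //= _ _ step.
- by rewrite (step (msr A)).
- by rewrite (step (msr A + msr B)) ?leq_addr // (step (msr A + msr B)) ?leq_addl.
- by split=> H a; apply/(step (msr A)); rewrite ?msr_inst //; apply: H.
- by split=> -[a H]; exists a; apply/(step (msr A)); rewrite ?msr_inst.
- by rewrite (step (msr A + #|` fvar A|)) // msr_uclos.
Qed.

Lemma forces_Atom (CS : formula -> Prop) (M : model CS) (Q : psym)
    (a : (arity Q).-tuple (dom M)) :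
  forces M (Atom (map_tuple (@inr Var (dom M)) a)) <-> @interp CS M Q a.
Proof.
rewrite /forces /=; split=> [[b eqab]|]; last by exists a.
suff -> : a = b by [].
apply/val_inj/(@inj_map _ _ (@inr Var (dom M))) => [y z [] //|].
by move: (congr1 val eqab).
Qed.

Lemma forces_Neg (CS : formula -> Prop) (M : model CS) (A : fml (dom M)) :
  forces M (Neg A) <-> ~ forces M A.
Proof. by []. Qed.

Lemma forces_Imp (CS : formula -> Prop) (M : model CS) (A B : fml (dom M)) :
  forces M (Imp A B) <-> (forces M A -> forces M B).
Proof.
by rewrite {1}/forces /= !forces_rec_msr ?leq_addr ?leq_addl.
Qed.

Lemma forces_All (CS : formula -> Prop) (M : model CS) (x : Var)
    (A : fml (dom M)) :
  forces M (All x A) <-> forall a, forces M (inst x a A).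
Proof.
by rewrite {1}/forces /=; split=> H a; have := H a;
  rewrite forces_rec_msr ?msr_inst.
Qed.

Lemma forces_Ex (CS : formula -> Prop) (M : model CS) (x : Var)
    (A : fml (dom M)) :
  forces M (Ex x A) <-> exists a, forces M (inst x a A).
Proof.
by rewrite {1}/forces /=; split=> -[a H]; exists a; move: H;
  rewrite forces_rec_msr ?msr_inst.
Qed.

Lemma forces_Box (CS : formula -> Prop) (M : model CS) (t : term)
    (X : {fset ind (dom M)}) (A : fml (dom M)) :
  forces M (Box t X A) <-> evid t A /\ forces M (uclos A).
Proof. by rewrite {1}/forces /= forces_rec_msr ?msr_uclos. Qed.

Definition valid (CS : formula -> Prop) (A : formula) : Prop :=
  forall M : model CS, forces M (emb (dom M) A).

(** * Tableaux *)

Definition branch := seq (fml Par).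

Definition new_to (u : Par) (b : branch) : Prop :=
  forall B, List.In B b -> u \notin kset B.

(* [rule b A cs]: the formula A on the branch b may be expanded, and cs lists,
   for each of the branches into which b then splits, the formulas added.
   Every rule leads from closed Par-formulas to closed Par-formulas; this is
   what the premise [Kformula A] of [rule_Ftimes] and [rule_Ins] is for. *)
Inductive rule (b : branch) : fml Par -> seq branch -> Prop :=
| rule_Fneg A : rule b (Neg (Neg A)) [:: [:: A]]
| rule_Timp A B : rule b (Imp A B) [:: [:: Neg A]; [:: B]]
| rule_Fimp A B : rule b (Neg (Imp A B)) [:: [:: A; Neg B]]
| rule_Tall x A u : rule b (All x A) [:: [:: inst x u A]]
| rule_Fex x A u : rule b (Neg (Ex x A)) [:: [:: Neg (inst x u A)]]
| rule_Tex x A u : new_to u b -> rule b (Ex x A) [:: [:: inst x u A]]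
| rule_Fall x A u :
    new_to u b -> rule b (Neg (All x A)) [:: [:: Neg (inst x u A)]]
| rule_Tbox t X A : rule b (BoxK t X A) [:: [:: uclos A]]
| rule_Fplus t s X A :
    rule b (Neg (BoxK (Plus t s) X A))
      [:: [:: Neg (BoxK t X A); Neg (BoxK s X A)]]
| rule_Ftimes s t X A B :
    Kformula A -> kset A `<=` X ->
    rule b (Neg (BoxK (Times s t) X B))
      [:: [:: Neg (BoxK s X (Imp A B))]; [:: Neg (BoxK t X A)]]
| rule_Fbang t X A :
    rule b (Neg (BoxK (Bang t) X (BoxK t X A))) [:: [:: Neg (BoxK t X A)]]
| rule_Ctr t X u A :
    u \notin X ->
    rule b (Neg (BoxK t X A)) [:: [:: Neg (BoxK t (u |` X) A)]]
| rule_Exp t X u A :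
    u \notin X -> u \notin kset A ->
    rule b (Neg (BoxK t (u |` X) A)) [:: [:: Neg (BoxK t X A)]]
| rule_Ins t X x u A :
    Kformula A ->
    rule b (Neg (BoxK t X (inst x u A))) [:: [:: Neg (BoxK t X A)]]
| rule_gen x t X A :
    rule b (Neg (BoxK (Gen x t) X (All x A))) [:: [:: Neg (BoxK t X A)]].

(* A finite tree is represented by the list of its branches. *)
Inductive tableau (S : branch) : seq branch -> Prop :=
| tableau_start : tableau S [:: S]
| tableau_ext T1 b T2 A cs :
    tableau S (T1 ++ b :: T2) -> List.In A b -> rule b A cs ->
    tableau S (T1 ++ [seq b ++ c | c <- cs] ++ T2).

Definition branch_closes (CS : formula -> Prop) (b : branch) : Prop :=
  (exists A, List.In A b /\ List.In (Neg A) b) \/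
  (exists c A, CS (Box (JC c) fset0 A) /\
     List.In (Neg (emb Par (Box (JC c) fset0 A))) b).

Definition tableau_closes (CS : formula -> Prop) (T : seq branch) : Prop :=
  forall b, List.In b T -> branch_closes CS b.

Definition tableau_provable (CS : formula -> Prop) (A : formula) : Prop :=
  exists T, tableau [:: Neg (emb Par A)] T /\ tableau_closes CS T.

(* Main.v *)
From Stdlib Require List.
From Stdlib Require Import Classical ClassicalEpsilon.
From mathcomp Require Import all_boot finmap.
Require Import Defs.

(* If the tableau for [Neg A] never closes, a fair expansion yields an infinite
   open branch, whose formulas form a Hintikka set G.  Take the parameters as
   domain, make an atom true iff it is in G, and put A in E(t) iff
   ~ t:_{Par(A)} A is not in G.  The rules (Ctr) and (Exp) make the index set
   irrelevant as long as it contains Par(A); the remaining rules for negated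
   justification formulas then say exactly that E satisfies its closure
   conditions. *)

Set Implicit Arguments.
Unset Strict Implicit.
Unset Printing Implicit Defensive.

Local Open Scope fset_scope.
Local Open Scope nat_scope.

(** * Finite sets *)

Lemma fresh_nat (S : {fset nat}) : exists u, u \notin S.
Proof.
exists (\max_(i <- S) i).+1; apply/negP => uS.
have := @leq_bigmax_seq _ (S : seq nat) xpredT (fun x => x) _ uS isT.
by rewrite ltnn.
Qed.

(** Removing from [Y] one element outside [X] at a time leads down to [X]. This serves to iterate
    (Ctr) and (Exp), which change an index set by a single parameter. *)
Lemma fsetU1_sup_ind (T : choiceType) (P : {fset T} -> Prop) (X Y : {fset T}) :
  X `<=` Y -> P X ->
  (forall u Z, X `<=` Z -> u \notin Z -> P Z -> P (u |` Z)) -> P Y.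
Proof.
move=> XY PX PU; have [n] := ubnP #|` Y|; elim: n Y XY => // n IHn Y XY le_n.
have [YX|/fsubsetPn[u uY uX]] := boolP (Y `<=` X).
  by have -> : Y = X by apply/eqP; rewrite eqEfsubset YX.
rewrite -(fsetD1K uY).
have XYu : X `<=` Y `\ u by rewrite fsubsetD1 XY.
apply: PU => //; first by rewrite !inE eqxx.
by apply: IHn => //; move: le_n; rewrite (cardfsD1 u Y) uY ltnS.
Qed.

(** * Structural characterization of K-formulas *)

Section Wf.
Variable K : choiceType.
Implicit Types (A : fml K) (x : nat) (a : K) (X : {fset ind K}).

Lemma mem_ivars (s : seq (ind K)) x : (x \in pmap (@ivar K) s) = (inl x \in s).
Proof.
rewrite mem_pmap; apply/mapP/idP => [[[y|a] // ys [->]] //|xs].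
by exists (inl x).
Qed.

Lemma mem_icsts (s : seq (ind K)) a : (a \in pmap (@icst K) s) = (inr a \in s).
Proof.
rewrite mem_pmap; apply/mapP/idP => [[[y|b] // ys [->]] //|xs].
by exists (inr a).
Qed.

Lemma fvar_BoxE t X A x : (x \in fvar (Box t X A)) = (inl x \in X).
Proof. by rewrite /= !inE mem_ivars. Qed.

(** [Kformula] is generated by substitution and gives no direct access to subformulas. The
    hereditary condition [wf] does, and is equivalent by [Kformula_wf] and [wf_Kformula]. *)
Fixpoint wf A : bool :=
  match A with
  | Atom _ _ => true
  | Neg A | All _ A | Ex _ A => wf A
  | Imp A B => wf A && wf B
  | Box _ X A => (kset A `<=` [fset a in pmap (@icst K) X]) && wf A
  end.

Lemma kset_inst x a A : kset (inst x a A) `<=` a |` kset A.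
Proof.
have sub_icst i b :
    isub x (inr a : ind K) i = inr b -> (b == a) || (i == inr b).
  by rewrite /isub; case: ifP => [_ [->]|_ ->]; rewrite eqxx ?orbT.
rewrite /inst; elim: A => [Q s|A IH|A IHA B IHB|y A IH|y A IH|t X A IH] //=.
- apply/fsubsetP => b; rewrite !inE !mem_icsts => /mapP[i is_ /esym/sub_icst].
  by case/orP=> [->//|/eqP <-]; rewrite is_ orbT.
- by rewrite fsubUset (fsubset_trans IHA) ?(fsubset_trans IHB) //;
    apply/fsetUS; rewrite ?fsubsetUl ?fsubsetUr.
- by case: eqP => // _; apply: fsubsetUr.
- by case: eqP => // _; apply: fsubsetUr.
- case: ifP => /= [xX|_]; last exact: fsubsetUr.
  apply/fsubsetP => b; rewrite !inE !mem_icsts.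
  case/orP=> [/imfsetP[i /= iX /esym/sub_icst]|/(fsubsetP IH)].
    by case/orP=> [->//|/eqP <-]; rewrite iX orbT.
  by rewrite !inE; case/orP=> ->; rewrite ?orbT.
Qed.

Lemma kset_sub_inst x a A : kset A `<=` kset (inst x a A).
Proof.
rewrite /inst; elim: A => [Q s|A IH|A IHA B IHB|y A IH|y A IH|t X A IH] //=.
- apply/fsubsetP => b; rewrite !inE !mem_icsts => bs.
  by apply/mapP; exists (inr b).
- exact: fsetUSS.
- by case: eqP.
- by case: eqP.
- case: ifP => //= xX; apply: fsetUSS => //.
  apply/fsubsetP => b; rewrite !inE !mem_icsts => bX.
  by apply/imfsetP; exists (inr b).
Qed.

Lemma wf_inst x a A : wf A -> wf (inst x a A).
Proof.
rewrite /inst; elim: A => [Q s|A IH|A IHA B IHB|y A IH|y A IH|t X A IH] //=.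
- by case/andP=> /IHA -> /IHB ->.
- by case: eqP.
- by case: eqP.
(* If [x] is in the index set, [a] enters it along with the body; otherwise the box is unchanged. *)
- case/andP=> AX wA; case: ifP => /= [xX|_]; last by rewrite AX.
  rewrite IH // andbT (fsubset_trans (kset_inst x a A)) //.
  apply/fsubsetP => b; rewrite !inE !mem_icsts => /orP[/eqP->|].
    by apply/imfsetP; exists (inl x); rewrite // /isub eqxx.
  move/(fsubsetP AX); rewrite !inE !mem_icsts => bX.
  by apply/imfsetP; exists (inr b).
Qed.

Lemma mem_iemb (X : {fset ind void}) i :
  (i \in [fset iemb K j | j in X]) = if i is inl x then inl x \in X else false.
Proof.
case: i => [x|a].
  apply/imfsetP/idP => [[[y|[]] /= yX [->]] //|xX]; by exists (inl x).
by apply/negP => /imfsetP[[y|[]]].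
Qed.

Lemma kset_emb (A : formula) : kset (emb K A) = fset0.
Proof.
elim: A => [Q s|A IH|A IHA B IHB|y A IH|y A IH|t X A IH] //=.
- apply/fsetP => b; rewrite !inE mem_icsts.
  by apply/negP => /mapP[[y|[]]].
- by rewrite IHA IHB fsetU0.
- by apply/fsetP => b; rewrite IH !inE mem_icsts mem_iemb.
Qed.

Lemma fvar_emb (A : formula) : fvar (emb K A) = fvar A.
Proof.
elim: A => [Q s|A IH|A IHA B IHB|y A IH|y A IH|t X A IH] //=; rewrite ?IH //.
- apply/fsetP => x; rewrite !inE mem_ivars mem_pmap.
  by apply/mapP/mapP => [[[y|[]] ys [->]]|[[y|[]] // ys [->]]]; exists (inl y).
- by rewrite IHA IHB.
- apply/fsetP => x; rewrite !inE mem_ivars mem_iemb mem_pmap.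
  by apply/idP/mapP => [xX|[[y|[]] // yX [->]] //]; exists (inl x).
Qed.

Lemma wf_emb (A : formula) : wf (emb K A).
Proof.
by elim: A => //= [A -> B -> //|t X A ->]; rewrite kset_emb fsub0set.
Qed.

Lemma Kformula_wf A : Kformula A -> wf A.
Proof. by elim=> [B|B x a _]; [apply: wf_emb|apply: wf_inst]. Qed.

(* The converse replaces the members of K one by one by fresh variables. *)
Definition iabs a x (i : ind K) : ind K := if i == inr a then inl x else i.

Fixpoint abs a x A : fml K :=
  match A with
  | Atom Q s => Atom (map_tuple (iabs a x) s)
  | Neg A => Neg (abs a x A)
  | Imp A B => Imp (abs a x A) (abs a x B)
  | All y A => All y (abs a x A)
  | Ex y A => Ex y (abs a x A)
  | Box t X A => Box t [fset iabs a x i | i in X] (abs a x A)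
  end.

(** Bound variables count too, and so do variables in the body of a box outside its index set: a
    variable [x] outside [vars A] meets no binder that could stop the substitution undoing [abs]. *)
Fixpoint vars A : {fset nat} :=
  match A with
  | Atom _ s => [fset x in pmap (@ivar K) s]
  | Neg A => vars A
  | Imp A B => vars A `|` vars B
  | All x A | Ex x A => x |` vars A
  | Box _ X A => [fset x in pmap (@ivar K) X] `|` vars A
  end.

Lemma iabs_id a x i : i != inr a -> iabs a x i = i.
Proof. by rewrite /iabs => /negbTE->. Qed.

Lemma imfset_id_in (f : ind K -> ind K) X :
  {in X, f =1 id} -> [fset f i | i in X] = X.
Proof.
move=> fX; apply/fsetP => i; apply/imfsetP/idP => [[j /= jX ->]|iX].
  by rewrite fX.
by exists i; rewrite ?fX.
Qed.

Lemma abs_id a x A : a \notin kset A -> abs a x A = A.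
Proof.
elim: A => [Q s|A IH|A IHA B IHB|y A IH|y A IH|t X A IH] //=.
- rewrite !inE mem_icsts => as_; congr Atom; apply: val_inj => /=.
  rewrite -[RHS]map_id; apply/eq_in_map => i is_; rewrite iabs_id //.
  by apply: contraNneq as_ => <-.
- by move/IH->.
- by rewrite inE negb_or => /andP[/IHA-> /IHB->].
- by move/IH->.
- by move/IH->.
- rewrite !inE mem_icsts negb_or => /andP[aX /IH->]; rewrite imfset_id_in //.
  by move=> i iX; rewrite iabs_id //; apply: contraNneq aX => <-.
Qed.

Lemma isub_iabs a x i : i != inl x -> isub x (inr a) (iabs a x i) = i.
Proof.
rewrite /isub /iabs; case: (i =P inr a) => [-> _|_ /negbTE-> //].
by rewrite eqxx.
Qed.

Lemma inst_abs a x A : wf A -> x \notin vars A -> inst x a (abs a x A) = A.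
Proof.
rewrite /inst; elim: A => [Q s|A IH|A IHA B IHB|y A IH|y A IH|t X A IH] //=.
- rewrite !inE mem_ivars => _ xs; congr Atom; apply: val_inj => /=.
  rewrite -map_comp -[RHS]map_id; apply/eq_in_map => i is_ /=.
  by rewrite isub_iabs //; apply: contraNneq xs => <-.
- by move=> wA xA; rewrite IH.
- by move=> /andP[wA wB]; rewrite inE negb_or => /andP[xA xB]; rewrite IHA ?IHB.
- move=> wA; rewrite !inE negb_or eq_sym => /andP[/negbTE-> xA].
  by rewrite IH.
- move=> wA; rewrite !inE negb_or eq_sym => /andP[/negbTE-> xA].
  by rewrite IH.
- case/andP=> AX wA; rewrite !inE mem_ivars negb_or => /andP[xX xA].
  (* If [a] is in [X], abstraction puts [x] into the index set, so [inst] reaches the body.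
     Otherwise [wf] keeps [a] out of the body, and both operations leave the box alone. *)
  have [aX|aX] := boolP (inr a \in X).
    rewrite ifT; last by apply/imfsetP; exists (inr a); rewrite // /iabs eqxx.
    rewrite IH // -imfset_comp imfset_id_in // => i iX /=.
    by rewrite isub_iabs //; apply: contraNneq xX => <-.
  rewrite imfset_id_in => [|i iX]; last first.
    by rewrite iabs_id //; apply: contraNneq aX => <-.
  rewrite (negbTE xX) abs_id //.
  by apply: contra aX => /(fsubsetP AX); rewrite !inE mem_icsts.
Qed.

Lemma iabs_inr a x i b : iabs a x i = inr b -> b != a /\ i = inr b.
Proof.
rewrite /iabs; case: eqP => // ia iE; split=> //.
by apply/eqP => ba; apply: ia; rewrite iE ba.
Qed.

Lemma kset_abs a x A : kset (abs a x A) = kset A `\ a.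
Proof.
elim: A => [Q s|A IH|A IHA B IHB|y A IH|y A IH|t X A IH] //=.
- apply/fsetP => b; rewrite !inE !mem_icsts; apply/mapP/andP.
    by case=> i is_ /esym/iabs_inr[-> <-].
  by case=> ba bs; exists (inr b); rewrite // iabs_id.
- by rewrite IHA IHB fsetDUl.
- rewrite IH fsetDUl; congr (_ `|` _).
  apply/fsetP => b; rewrite !inE !mem_icsts; apply/imfsetP/andP.
    by case=> i is_ /esym/iabs_inr[-> <-].
  by case=> ba bs; exists (inr b); rewrite // iabs_id.
Qed.

Lemma wf_abs a x A : wf A -> wf (abs a x A).
Proof.
elim: A => //= [A IHA B IHB|t X A IH].
  by case/andP=> /IHA-> /IHB->.
case/andP=> AX /IH->; rewrite andbT kset_abs; apply/fsubsetP => b.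
rewrite !inE !mem_icsts => /andP[ba /(fsubsetP AX)].
rewrite !inE mem_icsts => bX; apply/imfsetP; exists (inr b) => //.
by rewrite iabs_id.
Qed.

(** The value [inl 0] is a dummy: [emb_strip] assumes [kset A] empty, so no member of [K] is met. *)
Definition istrip (i : ind K) : ind void := if i is inl x then inl x else inl 0.

Fixpoint strip A : formula :=
  match A with
  | Atom Q s => Atom (map_tuple istrip s)
  | Neg A => Neg (strip A)
  | Imp A B => Imp (strip A) (strip B)
  | All y A => All y (strip A)
  | Ex y A => Ex y (strip A)
  | Box t X A => Box t [fset istrip i | i in X] (strip A)
  end.

Lemma emb_strip A : kset A = fset0 -> emb K (strip A) = A.
Proof.
have noK X a : [fset a in pmap (@icst K) X] = fset0 -> inr a \notin X.
  by move/fsetP/(_ a); rewrite !inE mem_icsts => ->.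
elim: A => [Q s|A IH|A IHA B IHB|y A IH|y A IH|t X A IH] //=.
- move/fsetP => s0; congr Atom; apply: val_inj => /=.
  rewrite -map_comp -[RHS]map_id; apply/eq_in_map => -[x|a] //= as_.
  by have := s0 a; rewrite !inE mem_icsts as_.
- by move/IH->.
- by move/eqP; rewrite fsetU_eq0 => /andP[/eqP/IHA-> /eqP/IHB->].
- by move/IH->.
- by move/IH->.
- move/eqP; rewrite fsetU_eq0 => /andP[/eqP X0 /eqP/IH->].
  rewrite -imfset_comp imfset_id_in // => -[x|a] //= aX.
  by have := noK X a X0; rewrite aX.
Qed.

Lemma wf_Kformula A : wf A -> Kformula A.
Proof.
have [n] := ubnP #|` kset A|; elim: n A => // n IHn A le_n wA.
have [/emb_strip <-|[a aA]] := fset_0Vmem (kset A); first exact: Kformula_emb.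
have [x xA] := fresh_nat (vars A).
rewrite -(inst_abs a wA xA); apply/Kformula_inst/IHn; last exact: wf_abs.
by rewrite kset_abs; move: le_n; rewrite (cardfsD1 a (kset A)) aA ltnS.
Qed.

Lemma icsts_inr (X : {fset K}) :
  [fset a in pmap (@icst K) [fset (inr a : ind K) | a in X]] = X.
Proof.
apply/fsetP => a; rewrite !inE mem_icsts.
by apply/imfsetP/idP => [[b /= bX [->]] //|aX]; exists a.
Qed.

(** The tableau rules for boxes are stated for [BoxK]; closedness keeps all variables out of the
    index set. *)
Lemma closed_BoxK t X A : closed (Box t X A) ->
  Box t X A = BoxK t [fset a in pmap (@icst K) X] A.
Proof.
move=> clA; congr Box; apply/fsetP => -[x|a].
  have /negbTE-> : inl x \notin X by rewrite -(fvar_BoxE t _ A) clA.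
  by apply/esym/negP => /imfsetP[].
apply/idP/imfsetP => [aX|[b /=]]; first by exists a; rewrite //= !inE mem_icsts.
by rewrite !inE mem_icsts => bX [->].
Qed.

Lemma closed_inst x a A : fvar A `\ x = fset0 -> closed (inst x a A).
Proof.
(* By [fvar_inst] only [x] remains to be excluded. That holds for every [A], so [clA] is dropped
   before the induction. *)
move=> clA; apply/eqP; rewrite -fsubset0 -clA fsubsetD1 fvar_inst /= {clA}.
have isubN i : isub x (inr a : ind K) i <> inl x.
  by rewrite /isub; case: eqP.
rewrite /inst; elim: A => [Q s|A IH|A IHA B IHB|y A IH|y A IH|t X A IH] //=.
- by rewrite !inE mem_ivars; apply/mapP => -[i _ /esym/isubN].
- by rewrite inE negb_or IHA.
- by case: eqP => [->|_]; rewrite !inE ?eqxx // negb_and IH orbT.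
- by case: eqP => [->|_]; rewrite !inE ?eqxx // negb_and IH orbT.
- case: ifP => xX /=; last by rewrite !inE mem_ivars xX.
  by rewrite !inE mem_ivars; apply/imfsetP => -[i _ /esym/isubN].
Qed.

Lemma closed_uclos A : closed (uclos A).
Proof.
have fvE s B : fvar (foldr (@All K) B s) = fvar B `\` [fset x in s].
  elim: s => [|x s IH] /=.
    by apply/fsetP => y; rewrite !inE.
  by rewrite IH; apply/fsetP => y; rewrite !inE negb_or andbA.
rewrite /closed /uclos fvE; apply/eqP; rewrite fsetD_eq0.
by apply/fsubsetP => x; rewrite !inE.
Qed.

Lemma wf_uclos A : wf (uclos A) = wf A.
Proof. by rewrite /uclos; elim: (enum_fset _). Qed.

End Wf.

(** * Codes of formulas *)

(** Injective codes, with a tag for each constructor, serve to schedule rule applications at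
    numbered stages. *)
Fixpoint term_code (t : term) : nat :=
  match t with
  | JV p => choice.pickle (0, p)
  | JC c => choice.pickle (1, c)
  | Plus s t => choice.pickle (2, choice.pickle (term_code s, term_code t))
  | Times s t => choice.pickle (3, choice.pickle (term_code s, term_code t))
  | Bang t => choice.pickle (4, term_code t)
  | Gen x t => choice.pickle (5, choice.pickle (x, term_code t))
  end.

Fixpoint fml_code (A : fml nat) : nat :=
  match A with
  | Atom Q s =>
      let s' : seq (nat + nat) := s in
      choice.pickle (0, choice.pickle (arity Q, pidx Q, s'))
  | Neg A => choice.pickle (1, fml_code A)
  | Imp A B => choice.pickle (2, choice.pickle (fml_code A, fml_code B))
  | All x A => choice.pickle (3, choice.pickle (x, fml_code A))
  | Ex x A => choice.pickle (4, choice.pickle (x, fml_code A))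
  | Box t X A =>
      let X' : seq (nat + nat) := X in
      choice.pickle (5, choice.pickle (term_code t, X', fml_code A))
  end.

Lemma pickle_inj (T : countType) : injective (@choice.pickle T).
Proof. exact: pcan_inj choice.pickleK. Qed.

Lemma term_code_inj : injective term_code.
Proof.
elim=> [p|c|s IHs t IHt|s IHs t IHt|t IH|x t IH]
  [p'|c'|s' t'|s' t'|t'|x' t'] //=
  /pickle_inj [] //.
- by move->.
- by move->.
- by move=> /pickle_inj[/IHs-> /IHt->].
- by move=> /pickle_inj[/IHs-> /IHt->].
- by move=> /IH->.
- by move=> /pickle_inj[-> /IH->].
Qed.

Lemma fml_code_inj : injective fml_code.
Proof.
elim=> [Q s|A IH|A IHA B IHB|y A IH|y A IH|t X A IH]
  [Q' s'|A'|A' B'|y' A'|y' A'|t' X' A'] //= /pickle_inj [] //.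
(* The types of the tuples depend on the arities; destructing the symbols turns these into variables
   that [subst] can identify. *)
- case: Q s => k i s; case: Q' s' => k' i' s' /pickle_inj[/= kk' ii' ss'].
  by subst k' i'; congr Atom; apply: val_inj.
- by move/IH->.
- by move=> /pickle_inj[/IHA-> /IHB->].
- by move=> /pickle_inj[-> /IH->].
- by move=> /pickle_inj[-> /IH->].
- by move=> /pickle_inj[/term_code_inj-> /val_inj-> /IH->].
Qed.

(* The index [j] makes every task [(A, cs)] recur infinitely often. *)
Definition task_code (j : nat) (A : fml nat) (cs : seq branch) : nat :=
  choice.pickle (j, fml_code A, map (map fml_code) cs).

Lemma task_code_inj j A cs j' A' cs' :
  task_code j A cs = task_code j' A' cs' -> [/\ j = j', A = A' & cs = cs'].
Proof.
by move=> /pickle_inj[-> /fml_code_inj->]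
  /(inj_map (inj_map fml_code_inj))->.
Qed.

(** Distinct indices [j] give distinct codes, so [m.+1] of them cannot all have codes below [m]. *)
Lemma task_code_unbounded A cs m : exists j, m <= task_code j A cs.
Proof.
apply: NNPP => nex.
have lt_m j : task_code j A cs < m.
  by rewrite ltnNge; apply/negP => ?; apply: nex; exists j.
have /leq_card : injective (fun j : 'I_m.+1 => Ordinal (lt_m j)).
  by move=> j k /(congr1 val) /task_code_inj[jk _ _]; apply: val_inj.
by rewrite !card_ord ltnn.
Qed.

(** * Open branches *)

Section Open.
Variable CS : formula -> Prop.

Definition closable (b : branch) : Prop :=
  exists T, tableau b T /\ tableau_closes CS T.

(** A rule, newness condition included, depends only on the branch that it extends. So the steps of
    a tableau for [b] can be repeated at a leaf [b] of another tableau. *)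
Lemma tableau_graft S T1 b T2 T :
  tableau S (T1 ++ b :: T2) -> tableau b T -> tableau S (T1 ++ T ++ T2).
Proof.
move=> tS; elim=> [|T1' b' T2' A cs _ IH Ab' rA] //.
have -> : T1 ++ (T1' ++ [seq b' ++ c | c <- cs] ++ T2') ++ T2 =
  (T1 ++ T1') ++ [seq b' ++ c | c <- cs] ++ (T2' ++ T2) by rewrite -!catA.
by apply: tableau_ext Ab' rA; rewrite -!catA in IH *.
Qed.

Lemma closable_rule b A cs : List.In A b -> rule b A cs ->
  (forall c, List.In c cs -> closable (b ++ c)) -> closable b.
Proof.
move=> Ab rA clc.
have := @tableau_ext b [::] b [::] A cs (tableau_start b) Ab rA.
rewrite cats0 cat0s => {rA} tb.
have : tableau b ([::] ++ [seq b ++ c | c <- cs]) by [].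
have : tableau_closes CS [::] by [].
(* The generalized [[::]] becomes an accumulator [T0] of closed branches; [cs] lists the extensions
   still to be closed. *)
elim: cs clc [::] {tb} => [|c cs IH] clc T0 cl0 /= tb.
  by exists T0; rewrite cats0 in tb.
have [|Tc [tTc clTc]] := clc c; first by left.
apply: (IH _ (T0 ++ Tc)).
- by move=> d dcs; apply: clc; right.
- by move=> d d_in; case: (List.in_app_or _ _ _ d_in) => [/cl0|/clTc].
- by rewrite -catA; apply: tableau_graft tb tTc.
Qed.

Lemma open_rule b A cs : ~ closable b -> List.In A b -> rule b A cs ->
  exists2 c, List.In c cs & ~ closable (b ++ c).
Proof.
move=> opb Ab rA; apply: NNPP => nex; apply: opb; apply: closable_rule Ab rA _.
by move=> c cs_c; apply: NNPP => opc; apply: nex; exists c.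
Qed.

Lemma fresh_par (b : branch) : exists u, new_to u b.
Proof.
suff [S bS] : exists S : {fset nat}, forall B, List.In B b -> kset B `<=` S.
  have [u uS] := fresh_nat S; exists u => B /bS /fsubsetP BS.
  by apply: contra uS; apply: BS.
elim: b => [|A b [S bS]]; first by exists fset0.
exists (kset A `|` S) => B [<-|/bS BS]; first exact: fsubsetUl.
by rewrite (fsubset_trans BS) ?fsubsetUr.
Qed.

(* [forall b0, rule b0 A cs] holds for the instances of the rules without a
   newness condition. *)
Definition treated (A : fml nat) (cs : seq branch) (G : fml nat -> Prop) :
    Prop :=
  match A with
  | Ex x B => exists u : nat, G (inst x u B)
  | Neg (All x B) => exists u : nat, G (Neg (inst x u B))
  | _ => (forall b0, rule b0 A cs) ->
      exists2 c, List.In c cs & forall B, List.In B c -> G B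
  end.

Lemma treated_mono A cs (G G' : fml nat -> Prop) :
  (forall B, G B -> G' B) -> treated A cs G -> treated A cs G'.
Proof.
move=> GG'.
have Hc : ((forall b0, rule b0 A cs) ->
      exists2 c, List.In c cs & forall B, List.In B c -> G B) ->
    (forall b0, rule b0 A cs) ->
      exists2 c, List.In c cs & forall B, List.In B c -> G' B.
  by move=> H /H[c cs_c cG]; exists c => // B /cG/GG'.
case: A Hc => [Q s|A|A B|y A|y A|t X A] //= Hc.
  by case: A Hc => [Q s|A|A B|y A|y A|t X A] //= _ [u /GG' Gu]; exists u.
by move=> [u /GG' Gu]; exists u.
Qed.

Lemma open_treat b A cs : ~ closable b -> List.In A b ->
  exists b', [/\ ~ closable b', List.incl b b' &
    treated A cs (fun B => List.In B b')].
Proof.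
move=> opb Ab; have [u ub] := fresh_par b.
have step cs' : rule b A cs' -> exists2 c, List.In c cs' & exists b',
    [/\ ~ closable b', List.incl b b' & forall B, List.In B c -> List.In B b'].
  case/(open_rule opb Ab) => c cs_c opc; exists c => //; exists (b ++ c).
  by split=> // [B Bb|B Bc]; apply: List.in_or_app; [left|right].
(* If [cs] is not the outcome of a rule for [A] on every branch, the implication in [treated] is
   vacuous and [b] itself serves. *)
have dft : exists b', [/\ ~ closable b', List.incl b b' &
    (forall b0, rule b0 A cs) -> exists2 c, List.In c cs &
      forall B, List.In B c -> List.In B b'].
  have [rA|nrA] := classic (forall b0, rule b0 A cs).
    have [c cs_c [b' [opb' bb' cb']]] := step _ (rA b).
    by exists b'; split=> // _; exists c.
  by exists b; split=> // B Bb.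
case: A Ab step dft => [Q s|A|A B|y A|y A|t X A] //= Ab step dft.
  case: A Ab step dft => [Q s|A|A B|y A|y A|t X A] //= Ab step _.
  have [_ [<-|//] [b' [opb' bb' cb']]] := step _ (rule_Fall y A ub).
  by exists b'; split=> //; exists u; apply: cb'; left.
have [_ [<-|//] [b' [opb' bb' cb']]] := step _ (rule_Tex y A ub).
by exists b'; split=> //; exists u; apply: cb'; left.
Qed.

Record hintikka (G : fml nat -> Prop) : Prop := Hintikka {
  hintikka_consistent : forall A, G A -> ~ G (Neg A);
  hintikka_cs : forall c A,
    CS (Box (JC c) fset0 A) -> ~ G (Neg (emb nat (Box (JC c) fset0 A)));
  hintikka_treated : forall A cs, G A -> treated A cs G
}.

(* Fairness replaces maximality: weakening of closed tableaux, which would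
   require renaming parameters, is not needed. *)
Lemma hintikka_ext b0 : ~ closable b0 ->
  exists2 G, hintikka G & forall A, List.In A b0 -> G A.
Proof.
move=> opb0; pose obranch := {b | ~ closable b}.
(* [p.1] is the number of the stage. By injectivity of [task_code] at most one task belongs to it;
   if there is none for a formula on the branch, the branch stays as it is. *)
pose next (p : nat * obranch) (b' : obranch) :=
  List.incl (sval p.2) (sval b') /\
  forall j A cs, task_code j A cs = p.1 -> List.In A (sval p.2) ->
    treated A cs (fun B => List.In B (sval b')).
have nextP p : {b' | next p b'}.
  apply: constructive_indefinite_description; case: p => n [b opb].
  have [[j [A [cs [<- Ab]]]]|nex] := classic (exists j A cs,
      task_code j A cs = n /\ List.In A b); last first.
    exists (exist _ b opb); split=> [//|j A cs /= eqn Ab].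
    by case: nex; exists j, A, cs.
  have [b' [opb' bb' trb']] := open_treat cs opb Ab.
  exists (exist _ b' opb'); split=> // j' A' cs' /= /task_code_inj[_ -> ->].
  by [].
pose b_ := fix b_ n : obranch :=
  if n is n'.+1 then sval (nextP (n', b_ n')) else exist _ b0 opb0.
have mono m n A : m <= n -> List.In A (sval (b_ m)) -> List.In A (sval (b_ n)).
  move=> /subnK<-; elim: (n - m) => // k IH Am.
  by have [bb' _] := svalP (nextP (k + m, b_ (k + m))); apply: bb'; apply: IH.
(* A closing stage would itself be a closed tableau with a single branch. *)
have opn n : ~ branch_closes CS (sval (b_ n)).
  move=> cl; apply: (svalP (b_ n)); exists [:: sval (b_ n)].
  by split=> [|d [<-|[]]] //; apply: tableau_start.
exists (fun A => exists n, List.In A (sval (b_ n))); last first.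
  by move=> A Ab0; exists 0.
split=> [A [m Am] [n An]|c A csA [n An]|A cs [m Am]].
- apply: (opn (maxn m n)); left; exists A.
  by split; [apply: mono Am|apply: mono An]; rewrite ?leq_maxl ?leq_maxr.
- by apply: (opn n); right; exists c, A.
(* Some copy of the task is due at a stage [n] not before [m], when [A] is already on the branch;
   its outcome is present at stage [n.+1]. *)
- have [j le_m] := task_code_unbounded A cs m.
  set n := task_code j A cs in le_m.
  have [_ /(_ j A cs erefl (mono _ _ _ le_m Am))] := svalP (nextP (n, b_ n)).
  by apply: treated_mono => B Bn; exists n.+1.
Qed.

End Open.

(** * The model of a Hintikka set *)

Section HintikkaModel.
Variables (CS : formula -> Prop) (G : fml nat -> Prop).
Hypothesis hG : hintikka CS G.

Definition needs_new (A : fml nat) : bool :=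
  match A with Ex _ _ | Neg (All _ _) => true | _ => false end.

Lemma hintikka_rule A cs : (forall b0, rule b0 A cs) -> ~~ needs_new A -> G A ->
  exists2 c, List.In c cs & forall B, List.In B c -> G B.
Proof.
move=> rA nA GA; have := hintikka_treated hG cs GA.
case: A nA rA {GA} => [Q s|A|A B|y A|y A|t X A] //= nA rA; last 3 first.
- by apply.
- by apply.
- by apply.
- by apply.
by case: A nA rA => [Q s|A|A B|y A|y A|t X A] //= _ rA; apply.
Qed.

Lemma hintikka_rule1 A c : (forall b0, rule b0 A [:: c]) -> ~~ needs_new A ->
  G A -> forall B, List.In B c -> G B.
Proof. by move=> rA nA /(hintikka_rule rA nA)[_ [<-|[]]]. Qed.

Lemma Neg_BoxK_sup t A (X Y : {fset nat}) :
  X `<=` Y -> G (Neg (BoxK t X A)) -> G (Neg (BoxK t Y A)).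
Proof.
move=> XY GX.
apply: (fsetU1_sup_ind (P := fun Z => G (Neg (BoxK t Z A))) XY GX) => /=.
move=> u Z _ uZ GZ.
by apply: (hintikka_rule1 (fun b0 => rule_Ctr b0 t A uZ) isT GZ); left.
Qed.

Lemma Neg_BoxK_sub t A (X Y : {fset nat}) :
  kset A `<=` X -> X `<=` Y -> G (Neg (BoxK t Y A)) -> G (Neg (BoxK t X A)).
Proof.
move=> AX XY.
(* With an implication for [P], the induction over growing sets strips [Y] down to [X]. Each
   parameter removed lies outside [X], hence outside [kset A], as (Exp) demands. *)
apply: (fsetU1_sup_ind (P := fun Z => G (Neg (BoxK t Z A)) -> _) XY) => //.
move=> /= u Z XZ uZ IH GuZ; apply: IH.
have uA : u \notin kset A.
  by apply: contra uZ; apply/fsubsetP/(fsubset_trans AX).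
by apply: (hintikka_rule1 (fun b0 => rule_Exp b0 t uZ uA) isT GuZ); left.
Qed.

(** The conjunct [Kformula A] provides the field [evid_Kformula] and the premises of [rule_Ftimes]
    and [rule_Ins]. *)
Definition hintikka_evid (t : term) (A : fml nat) : Prop :=
  Kformula A /\ ~ G (Neg (BoxK t (kset A) A)).

Lemma hintikka_evid_Neg t X A : 
  hintikka_evid t A -> kset A `<=` X -> ~ G (Neg (BoxK t X A)).
Proof. by move=> [_ nG] AX /(Neg_BoxK_sub (fsubset_refl _) AX). Qed.

Lemma hintikka_evid_cs c A : CS (Box (JC c) fset0 A) ->
  hintikka_evid (JC c) (emb nat A).
Proof.
move=> csA; split; first exact: Kformula_emb.
by have := hintikka_cs hG csA; rewrite kset_emb /= /BoxK !imfset0.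
Qed.

Lemma hintikka_evid_app s t A B :
  hintikka_evid s (Imp A B) -> hintikka_evid t A -> hintikka_evid (Times s t) B.
Proof.
move=> sAB tA; have [KAB _] := sAB; have [KA _] := tA.
split=> [|GB].
  by have /andP[_ /wf_Kformula] := Kformula_wf KAB.
(* The index set must contain [kset A] before the rule for application can introduce [A]; (Ctr)
   enlarges it. *)
have GB' := Neg_BoxK_sup (fsubsetUr (kset A) _) GB.
have [c cs_c cG] := hintikka_rule
  (fun b0 => rule_Ftimes b0 s t B KA (fsubsetUl _ (kset B))) isT GB'.
case: cs_c cG => [<-|[<-|[]]] cG.
  by apply: (hintikka_evid_Neg sAB (fsubset_refl _)); apply: cG; left.
by apply: (hintikka_evid_Neg tA (fsubsetUl _ (kset B))); apply: cG; left.
Qed.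

Lemma hintikka_evid_plus s t A : hintikka_evid s A \/ hintikka_evid t A ->
  hintikka_evid (Plus s t) A.
Proof.
move=> stA; split=> [|GA]; first by case: stA => -[].
have Gst := hintikka_rule1 (fun b0 => rule_Fplus b0 s t _ A) isT GA.
case: stA => [] [_]; apply; apply: Gst; first by left.
by right; left.
Qed.

Lemma hintikka_evid_bang t A (X : {fset nat}) :
  hintikka_evid t A -> kset A `<=` X -> hintikka_evid (Bang t) (BoxK t X A).
Proof.
move=> tA AX; have [KA _] := tA; split=> [|GA].
  by apply: wf_Kformula; rewrite /= icsts_inr AX Kformula_wf.
(* The index set in [GA] is thus exactly [X], the shape that (F!) requires. *)
have kX : kset (BoxK t X A) = X by rewrite /= icsts_inr; apply/fsetUidPl.
rewrite kX in GA; apply: (hintikka_evid_Neg tA AX).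
by apply: (hintikka_rule1 (fun b0 => rule_Fbang b0 t X A) isT GA); left.
Qed.

Lemma hintikka_evid_gen t x A : hintikka_evid t A ->
  hintikka_evid (Gen x t) (All x A).
Proof.
move=> tA; have [KA _] := tA; split=> [|GA].
  exact/wf_Kformula/(Kformula_wf KA).
apply: (hintikka_evid_Neg tA (fsubset_refl _)).
by apply: (hintikka_rule1 (fun b0 => rule_gen b0 x t _ A) isT GA); left.
Qed.

Lemma hintikka_evid_inst t x (u : nat) A : hintikka_evid t A ->
  hintikka_evid t (inst x u A).
Proof.
move=> tA; have [KA _] := tA; split=> [|GA]; first exact: Kformula_inst.
(* (Ins) keeps the index set, which still covers [kset A] because instantiation loses no
   parameter. *)
apply: (hintikka_evid_Neg tA (kset_sub_inst x u A)).
by apply: (hintikka_rule1 (fun b0 => rule_Ins b0 t _ x u KA) isT GA); left.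
Qed.

Definition hintikka_model : model CS :=
  @Model CS nat (inhabits 0)
    (fun Q a => G (Atom (map_tuple (@inr nat nat) a)))
    hintikka_evid (fun t A tA => proj1 tA) hintikka_evid_cs
    hintikka_evid_app hintikka_evid_plus hintikka_evid_bang
    hintikka_evid_gen hintikka_evid_inst.

Lemma closed_Atom Q (s : (arity Q).-tuple (ind nat)) : closed (Atom s) ->
  exists a, s = map_tuple (@inr nat nat) a.
Proof.
(* The default [0] is never taken, since a closed atom has no variable among its arguments. *)
move=> /fsetP cl; exists (map_tuple (fun i => if i is inr a then a else 0) s).
apply: val_inj; rewrite /= -map_comp -[LHS]map_id.
apply/eq_in_map => -[x|//] xs.
by have := cl x; rewrite !inE mem_ivars xs.
Qed.

(** [G] need not decide every formula, so both signs are carried as separate implications. The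
    induction is on [msr], because instances and universal closures are not subformulas; [wf]
    ensures that index sets contain the parameters of their bodies. *)
Lemma hintikka_model_forces (A : fml nat) : closed A -> wf A ->
  (G A -> forces hintikka_model A) /\ (G (Neg A) -> ~ forces hintikka_model A).
Proof.
have [n] := ubnP (msr A); elim: n A => // n IHn A le_n clA wA.
case: A le_n clA wA => [Q s|A|A B|x A|x A|t X A] le_n clA wA;
  rewrite /= in le_n wA.
- have [a ->] := closed_Atom clA; rewrite forces_Atom /=.
  by split=> // GN GA; apply: (hintikka_consistent hG GA).
- have [TA FA] := IHn A le_n clA wA; split=> [/FA //|GA /forces_Neg].
  by apply; apply/TA/(hintikka_rule1 (fun b0 => rule_Fneg b0 A) isT GA); left.
- have /andP[/eqP clA' /eqP clB] : (fvar A == fset0) && (fvar B == fset0).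
    by rewrite -fsetU_eq0; apply/eqP.
  case/andP: wA => wA wB.
  have [TA FA] := IHn A (leq_ltn_trans (leq_addr _ _) le_n) clA' wA.
  have [TB FB] := IHn B (leq_ltn_trans (leq_addl _ _) le_n) clB wB.
  rewrite forces_Imp; split=> GAB.
    have [c cs_c cG] := hintikka_rule (fun b0 => rule_Timp b0 A B) isT GAB.
    case: cs_c cG => [<-|[<-|[]]] cG.
      by move=> fA; case: (FA _ fA); apply: cG; left.
    by move=> _; apply/TB/cG; left.
  have GA := hintikka_rule1 (fun b0 => rule_Fimp b0 A B) isT GAB.
  move=> AB; apply: FB; first by apply: GA; right; left.
  by apply/AB/TA/GA; left.
- have IHx u : (G (inst x u A) -> forces hintikka_model (inst x u A)) /\
      (G (Neg (inst x u A)) -> ~ forces hintikka_model (inst x u A)).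
    by apply: IHn; [apply: leq_ltn_trans (msr_inst _ _ _) _|
      apply: closed_inst|apply: wf_inst].
  rewrite forces_All; split=> [GA u|GA fA].
    apply: (proj1 (IHx u)).
    by apply: (hintikka_rule1 (fun b0 => rule_Tall b0 x A u) isT GA); left.
  (* For a negated universal formula [treated] ignores the list, so [[::]] is a placeholder. *)
  have [u Gu] := hintikka_treated hG [::] GA.
  by apply: (proj2 (IHx u) Gu); apply: fA.
- have IHx u : (G (inst x u A) -> forces hintikka_model (inst x u A)) /\
      (G (Neg (inst x u A)) -> ~ forces hintikka_model (inst x u A)).
    by apply: IHn; [apply: leq_ltn_trans (msr_inst _ _ _) _|
      apply: closed_inst|apply: wf_inst].
  rewrite forces_Ex; split=> [GA|GA [u]].
    have [u Gu] := hintikka_treated hG [::] GA.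
    by exists u; apply: (proj1 (IHx u)).
  apply: (proj2 (IHx u)).
  by apply: (hintikka_rule1 (fun b0 => rule_Fex b0 x A u) isT GA); left.
- case/andP: wA => AX wA; rewrite (closed_BoxK clA).
  set Y := [fset a in _] in AX *.
  have KA := wf_Kformula wA.
  (* If the box is in [G], a negated box with index set [kset A] would grow by (Ctr) to index set
     [Y], against consistency, and (T:) yields the closure. If its negation is in [G], the evidence
     fails. *)
  rewrite forces_Box; split=> [GA|GA [tA _]]; first split.
      split=> // GN; apply: (hintikka_consistent hG GA).
      exact: Neg_BoxK_sup AX GN.
    apply: (proj1 (IHn _ _ _ _)); rewrite ?msr_uclos ?wf_uclos //.
      exact: closed_uclos.
    by apply: (hintikka_rule1 (fun b0 => rule_Tbox b0 t Y A) isT GA); left.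
  by apply: (hintikka_evid_Neg tA AX).
Qed.

End HintikkaModel.

Theorem theorem3p2 (CS : formula -> Prop) (hCS : const_spec CS)
    (A : formula) (hA : sentence A) :
  valid CS A -> tableau_provable CS A.
Proof.
(* [tableau_provable CS A] unfolds to closability of the branch consisting of the negation of
   [A]. *)
move=> vA; apply: NNPP => /hintikka_ext[G hG GA].
have [||_ F] := @hintikka_model_forces CS G hG (emb nat A).
- by rewrite /closed fvar_emb.
- exact: wf_emb.
- by apply: F (vA (hintikka_model hG)); apply: GA; left.
Qed.
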